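(* If $G$ and $H$ are countable discrete groups with property A, then the reduced wreath product $G\wr H$ has property A.
   Context: The reduced wreath product $G\wr H$ is the semidirect product $\left(\bigoplus_{h\in H}G\right)\rtimes H$, where $H$ acts on the direct sum (finitely supported functions $H\to G$) by permuting the copies of $G$ via translation of the index set $H$. Property A: a discrete metric space $(X,d)$ has property A if for all $R,\epsilon>0$ there exists a family $\{A_x\}_{x\in X}$ of finite, non-empty subsets of $X\times\mathbb{N}$ such that (i) for all $x,y\in X$ with $d(x,y)\le R$ we have $\frac{|A_x\triangle A_y|}{|A_x\cap A_y|}<\epsilon$; (ii) there exists $S$ such that for each $x\in X$, if $(y,n)\in A_x$ then $d(x,y)\le S$. Groups as metric spaces: a discrete metric space $X$ has bounded geometry if for all $r>0$ there is $N_r$ with $|B(x,r)|<N_r$ for all $x\in X$. Every countable discrete group $G$ admits a left-invariant metric ($d(hg,hg')=d(g,g')$) of bounded geometry, and any two such metrics are coarsely equivalent via the identity map. A countable discrete group is said to have property A if it has property A as a metric space with respect to some (equivalently, every) left-invariant bounded geometry metric. *)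

(* Defs.v *)
From HB Require Import structures.
From mathcomp Require Import all_boot all_order all_algebra finmap.
From mathcomp Require Import boolp classical_sets functions cardinality reals.

Set Implicit Arguments.
Unset Strict Implicit.
Unset Printing Implicit Defensive.

Import Order.TTheory GRing.Theory Num.Theory.
Local Open Scope ring_scope.

(* A group carries many metrics, so distances are plain functions on a fixed  *)
(* carrier, rather than a metricType structure attached to that carrier.      *)

Definition is_metric (R : realType) (X : Type) (d : X -> X -> R) : Prop :=
  [/\ forall x y, 0 <= d x y,
      forall x y, d x y = 0 <-> x = y,
      forall x y, d x y = d y x
    & forall x y z, d x z <= d x y + d y z].

Definition mball (R : realType) (X : Type) (d : X -> X -> R) (x : X) (r : R)
    : set X :=
  [set y | d x y <= r]%classic.

(* fset_set of an infinite set is fset0, whence the finiteness clause. *)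
Definition bounded_geometry (R : realType) (X : choiceType) (d : X -> X -> R)
    : Prop :=
  forall r : R, 0 < r -> exists N : nat, forall x : X,
    finite_set (mball d x r) /\ (#|` fset_set (mball d x r)| < N)%N.

(* In (i) the ratio |A x symdiff A y| / |A x cap A y| only makes sense when   *)
(* A x and A y meet; this has to be required explicitly, since in a fieldType *)
(* z / 0 = 0, so that disjoint A x and A y would otherwise satisfy (i).       *)
Definition property_A (R : realType) (X : choiceType) (d : X -> X -> R)
    : Prop :=
  forall r e : R, 0 < r -> 0 < e ->
  exists A : X -> {fset X * nat},
  [/\ forall x, A x != fset0,
      (* (i) *)
      forall x y, d x y <= r ->
        (A x `&` A y != fset0)%fset /\
        (#|` (A x `\` A y) `|` (A y `\` A x)|%fset)%:R
          / (#|` A x `&` A y|%fset)%:R < e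
    & (* (ii) *)
      exists S : R, forall (x y : X) (n : nat), (y, n) \in A x -> d x y <= S].

Definition left_invariant (R : realType) (G : groupType) (d : G -> G -> R)
    : Prop :=
  forall h g g' : G, d (h * g)%g (h * g')%g = d g g'.

(* Balls of a bounded geometry metric are finite, so this entails that G is   *)
(* countable.                                                                 *)
Definition group_property_A (R : realType) (G : groupType) : Prop :=
  exists d : G -> G -> R,
    [/\ is_metric d, left_invariant d, bounded_geometry d & property_A d].

Definition direct_sum (I : choiceType) (G : groupType) : Type :=
  {fsfun I -> G with 1%g}.

Section DirectSum.
Variables (I : choiceType) (G : groupType).
Local Open Scope group_scope.

HB.instance Definition _ := Choice.on (direct_sum I G).

Implicit Types f g : direct_sum I G.

Definition dsum_one : direct_sum I G := [fsfun of _ => 1].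

Definition dsum_mul f g : direct_sum I G :=
  [fsfun i in (finsupp f `|` finsupp g)%fset => f i * g i].

Definition dsum_inv f : direct_sum I G := [fsfun i in finsupp f => (f i)^-1].

Lemma dsum_oneE i : dsum_one i = 1.
Proof. by rewrite fsfunE. Qed.

Lemma dsum_mulE f g i : dsum_mul f g i = f i * g i.
Proof.
rewrite fsfunE in_fsetU.
by case: finsuppP => [_|//]; case: finsuppP => [_|//]; rewrite mulg1.
Qed.

Lemma dsum_invE f i : dsum_inv f i = (f i)^-1.
Proof. by rewrite fsfunE; case: finsuppP => //; rewrite invg1. Qed.

Fact dsum_mulgA : associative dsum_mul.
Proof. by move=> f g h; apply/fsfunP => i; rewrite !dsum_mulE mulgA. Qed.
Fact dsum_mul1g : left_id dsum_one dsum_mul.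
Proof. by move=> f; apply/fsfunP => i; rewrite dsum_mulE dsum_oneE mul1g. Qed.
Fact dsum_mulg1 : right_id dsum_one dsum_mul.
Proof. by move=> f; apply/fsfunP => i; rewrite dsum_mulE dsum_oneE mulg1. Qed.
Fact dsum_mulVg : left_inverse dsum_one dsum_inv dsum_mul.
Proof.
by move=> f; apply/fsfunP => i; rewrite dsum_mulE dsum_invE dsum_oneE mulVg.
Qed.
Fact dsum_mulgV : right_inverse dsum_one dsum_inv dsum_mul.
Proof.
by move=> f; apply/fsfunP => i; rewrite dsum_mulE dsum_invE dsum_oneE mulgV.
Qed.

HB.instance Definition _ := isGroup.Build (direct_sum I G)
  dsum_mulgA dsum_mul1g dsum_mulg1 dsum_mulVg dsum_mulgV.

End DirectSum.

Definition wreath (G H : groupType) : Type := (direct_sum H G * H)%type.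

Section Wreath.
Variables G H : groupType.
Local Open Scope group_scope.

Implicit Types (f g : direct_sum H G) (h k : H) (x y z : wreath G H).

(* The translate of f by h: it moves the copy of G at j to the one at h * j. *)
Definition translate h f : direct_sum H G :=
  [fsfun k in [fset h * j | j in finsupp f]%fset => f (h^-1 * k)].

Lemma translateE h f k : translate h f k = f (h^-1 * k).
Proof.
rewrite fsfunE; case: imfsetP => //= nk; apply/esym/fsfun_dflt/negP => fk.
by apply: nk; exists (h^-1 * k) => //; rewrite mulVKg.
Qed.

Lemma translate1 f : translate 1 f = f.
Proof. by apply/fsfunP => k; rewrite translateE invg1 mul1g. Qed.

Lemma translateM h k f : translate (h * k) f = translate h (translate k f).
Proof. by apply/fsfunP => i; rewrite !translateE invgM mulgA. Qed.

Lemma translate_mul h f g :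
  translate h (f * g) = translate h f * translate h g.
Proof.
by apply/fsfunP => i; rewrite !(translateE, dsum_mulE).
Qed.

Lemma translate_one h : translate h 1 = 1.
Proof. by apply/fsfunP => i; rewrite translateE !dsum_oneE. Qed.

HB.instance Definition _ := Choice.on (wreath G H).

Definition wreath_one : wreath G H := (1, 1).
Definition wreath_mul x y : wreath G H := (x.1 * translate x.2 y.1, x.2 * y.2).
Definition wreath_inv x : wreath G H := (translate x.2^-1 x.1^-1, x.2^-1).

Fact wreath_mulgA : associative wreath_mul.
Proof.
by move=> x y z; congr pair; rewrite /= ?translate_mul ?translateM mulgA.
Qed.
Fact wreath_mul1g : left_id wreath_one wreath_mul.
Proof. by case=> f h; congr pair; rewrite /= ?translate1 mul1g. Qed.
Fact wreath_mulg1 : right_id wreath_one wreath_mul.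
Proof. by case=> f h; congr pair; rewrite /= ?translate_one mulg1. Qed.
Fact wreath_mulVg : left_inverse wreath_one wreath_inv wreath_mul.
Proof.
by case=> f h; congr pair; rewrite /= -?translate_mul mulVg ?translate_one.
Qed.
Fact wreath_mulgV : right_inverse wreath_one wreath_inv wreath_mul.
Proof.
case=> f h; congr pair; rewrite /= -?translateM mulgV //.
by rewrite translate1 mulgV.
Qed.

HB.instance Definition _ := isGroup.Build (wreath G H)
  wreath_mulgA wreath_mul1g wreath_mulg1 wreath_mulVg wreath_mulgV.

End Wreath.

(* Main.v *)
Require Import Defs.
From HB Require Import structures.
From mathcomp Require Import all_boot all_order all_algebra finmap.
From mathcomp Require Import boolp classical_sets functions cardinality reals.
From mathcomp Require Import lra.

(* For a group G, property A amounts to Reiter's condition: for each finite E *)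
(* and e > 0 there are probability measures xi x, supported in x * S for some *)
(* fixed finite S, such that xi x and xi y are e-close in l1 if x^-1 * y is   *)
(* in E. The sets A x give the xi x as images of uniform measures, and A x is *)
(* recovered as the region below the graph of K * xi x, rounded down, for a   *)
(* large K. Whereas the A x may have unrelated sizes, measures can be         *)
(* averaged (bind), and averages of l1-close families against l1-close        *)
(* measures are l1-close. This yields Reiter's condition for finitely many    *)
(* coordinates of the direct sum, and then for the wreath product: from (n,   *)
(* q), choose p near q in H, then move p^-1 n within the direct sum.          *)
(* Replacing (n, q) by (n, q) * (m, t) changes p^-1 n by a factor (p^-1 q) m  *)
(* on the right, and these factors form a finite set since p^-1 q does.       *)

Set Implicit Arguments.
Unset Strict Implicit.
Unset Printing Implicit Defensive.

Import Order.TTheory GRing.Theory Num.Theory.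
Local Open Scope fset_scope.
Local Open Scope ring_scope.

(** [reiter] mentions no metric, so the argument can stay inside the groups. [property_A_reiter]
    enters it from whichever metrics witness property A of G and H, and [reiter_property_A] leaves
    it for any left-invariant metric of bounded geometry. [word_dist] provides such a metric on the
    wreath product, which is countable by [countable_wreath]. The permanence itself is
    [reiter_wreath]. It rests on [direct_sum_kernel] and on the estimate [bind_close], by which the
    errors of successive random choices add up. *)

Notation fmeas R X := {fsfun X -> R%type with 0%R}.

(** * Finitely supported probability measures *)

Section Prob.
Variable R : realType.
Implicit Types X Y Z : choiceType.

Definition is_prob X (mu : fmeas R X) : Prop :=
  (forall x, 0 <= mu x) /\ \sum_(x <- finsupp mu) mu x = 1.

(** Bounding all finite partial sums expresses that the l1 distance is at most [e] without infinite
    sums, and the bound can be used on any convenient finite set. *)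
Definition l1close X (e : R) (mu nu : X -> R) : Prop :=
  forall F : {fset X}, \sum_(x <- F) `|mu x - nu x| <= e.

Definition dirac X (x : X) : fmeas R X := [fsfun y in [fset x] => 1].

Definition bind X Y (mu : fmeas R X) (k : X -> fmeas R Y) : fmeas R Y :=
  [fsfun y in \bigcup_(x <- finsupp mu) finsupp (k x) =>
     \sum_(x <- finsupp mu) mu x * k x y].

Lemma diracE X (x y : X) : dirac x y = (y == x)%:R.
Proof. by rewrite fsfunE inE; case: eqP. Qed.

Lemma finsupp_dirac X (x : X) : finsupp (dirac x) = [fset x].
Proof.
by apply/fsetP => y; rewrite mem_finsupp diracE inE pnatr_eq0 eqb0 negbK.
Qed.

Lemma dirac_prob X (x : X) : is_prob (dirac x).
Proof.
split=> [y|]; first by rewrite diracE.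
by rewrite finsupp_dirac big_seq_fset1 diracE eqxx.
Qed.

Lemma sum_finsupp X (mu : fmeas R X) (h : X -> R) (F : {fset X}) :
  (finsupp mu `<=` F)%fset ->
  \sum_(x <- finsupp mu) mu x * h x = \sum_(x <- F) mu x * h x.
Proof.
by move=> sF; apply: big_fset_incl => // x _ /fsfun_dflt ->; rewrite mul0r.
Qed.

Lemma mass_finsupp X (mu : fmeas R X) (F : {fset X}) :
  (finsupp mu `<=` F)%fset ->
  \sum_(x <- finsupp mu) mu x = \sum_(x <- F) mu x.
Proof. by move=> sF; apply: big_fset_incl => // x _ /fsfun_dflt ->. Qed.

Lemma ler_sum_fset X (mu : X -> R) (F F' : {fset X}) :
  (forall x, 0 <= mu x) -> (F `<=` F')%fset ->
  \sum_(x <- F) mu x <= \sum_(x <- F') mu x.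
Proof.
move=> mu0 sF; rewrite [leRHS](big_fsetID _ (mem F)) /=.
have -> : [fset x in F' | x \in F] = F.
  apply/fsetP => x; rewrite !inE /= andbC; case xF: (x \in F) => //=.
  exact: (fsubsetP sF).
by rewrite lerDl sumr_ge0.
Qed.

Lemma prob_le1 X (mu : fmeas R X) (F : {fset X}) :
  is_prob mu -> \sum_(x <- F) mu x <= 1.
Proof.
move=> [mu0 mu1]; rewrite -mu1 (mass_finsupp (fsubsetUr F (finsupp mu))).
by apply: ler_sum_fset; rewrite ?fsubsetUl.
Qed.

Lemma bindE X Y (mu : fmeas R X) (k : X -> fmeas R Y) y :
  bind mu k y = \sum_(x <- finsupp mu) mu x * k x y.
Proof.
rewrite fsfunE; case: ifPn => // /bigfcupP yk.
rewrite big_seq big1 // => x xmu; rewrite [k x y]fsfun_dflt ?mulr0 //.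
by apply/negP => yx; apply: yk; exists x; rewrite ?xmu.
Qed.

Lemma bind_finsupp X Y (mu : fmeas R X) (k : X -> fmeas R Y) y :
  y \in finsupp (bind mu k) ->
  exists2 x, x \in finsupp mu & y \in finsupp (k x).
Proof.
move=> ymk; apply: contrapT => nx; move: ymk; rewrite mem_finsupp bindE.
rewrite big_seq big1 ?eqxx // => x xmu; rewrite [k x y]fsfun_dflt ?mulr0 //.
by apply/negP => yx; apply: nx; exists x.
Qed.

Lemma bind_prob X Y (mu : fmeas R X) (k : X -> fmeas R Y) :
  is_prob mu -> (forall x, x \in finsupp mu -> is_prob (k x)) ->
  is_prob (bind mu k).
Proof.
move=> [mu0 mu1] pk; split=> [y|].
  rewrite bindE big_seq sumr_ge0 // => x /pk[k0 _]; exact: mulr_ge0.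
have sB : (finsupp (bind mu k) `<=`
    \bigcup_(x <- finsupp mu) finsupp (k x))%fset.
  apply/fsubsetP => y /bind_finsupp[x xmu yx].
  by apply/bigfcupP; exists x; rewrite ?xmu.
rewrite (mass_finsupp sB).
rewrite (eq_bigr _ (fun y _ => bindE mu k y)).
rewrite exchange_big -mu1 /= big_seq [RHS]big_seq; apply: eq_bigr => x xmu.
rewrite -mulr_sumr -mass_finsupp ?(pk x xmu).2 ?mulr1 //.
by apply: bigfcup_sup.
Qed.

(** From mu k - nu l = (mu - nu) l + mu (k - l): the first term contributes at most [e] because each
    [l x] has mass 1, the second at most [e'] because [mu] has mass 1. *)
Lemma bind_close X Y (mu nu : fmeas R X) (k l : X -> fmeas R Y) (e e' : R) :
    is_prob mu -> (forall x, is_prob (l x)) -> 0 <= e' ->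
    l1close e mu nu ->
    (forall x, x \in finsupp mu -> l1close e' (k x) (l x)) ->
  l1close (e + e') (bind mu k) (bind nu l).
Proof.
move=> pmu pl e'0 munu kl F; pose U := finsupp mu `|` finsupp nu.
have sm : (finsupp mu `<=` U)%fset by exact: fsubsetUl.
have sn : (finsupp nu `<=` U)%fset by exact: fsubsetUr.
have dE y : `|bind mu k y - bind nu l y| <=
    \sum_(x <- U) (`|mu x - nu x| * l x y + mu x * `|k x y - l x y|).
  rewrite !bindE (sum_finsupp _ sm) (sum_finsupp _ sn) -sumrB.
  apply: le_trans (ler_norm_sum _ _ _) _; apply: ler_sum => x _.
  have -> : mu x * k x y - nu x * l x y =
      (mu x - nu x) * l x y + mu x * (k x y - l x y) by lra.
  apply: le_trans (ler_normD _ _) _.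
  by rewrite !normrM (ger0_norm ((pl x).1 y)) (ger0_norm (pmu.1 x)).
apply: le_trans (ler_sum _ (fun y _ => dE y)) _.
rewrite exchange_big /=; under eq_bigr do rewrite big_split /= -!mulr_sumr.
rewrite big_split /=; apply: lerD.
  apply: le_trans (munu U); apply: ler_sum => x _.
  by rewrite ler_piMr // prob_le1.
rewrite -sum_finsupp //.
rewrite -[leRHS]mul1r -pmu.2 mulr_suml big_seq [leRHS]big_seq.
apply: ler_sum => x xmu; apply: ler_wpM2l; [exact: pmu.1|exact: kl].
Qed.

Lemma l1close_refl X (mu : X -> R) : l1close 0 mu mu.
Proof. by move=> F; rewrite big1 // => x _; rewrite subrr normr0. Qed.

Lemma bind_close_same X Y (mu nu : fmeas R X) (k : X -> fmeas R Y) (e : R) :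
  is_prob mu -> (forall x, is_prob (k x)) -> l1close e mu nu ->
  l1close e (bind mu k) (bind nu k).
Proof.
move=> pmu pk munu; rewrite -[e]addr0; apply: bind_close => // x _.
exact: l1close_refl.
Qed.

End Prob.

(** * Reiter kernels *)

Section Reiter.
Variable R : realType.

Definition kernel_in (G : groupType) (S : {fset G}) (xi : G -> fmeas R G) :=
  (forall x, is_prob (xi x)) /\
  (forall x z, z \in finsupp (xi x) -> (x^-1 * z)%g \in S).

Definition reiter (G : groupType) : Prop :=
  forall (E : {fset G}) (e : R), 0 < e ->
  exists S xi, kernel_in S xi /\
    forall x y, (x^-1 * y)%g \in E -> l1close e (xi x) (xi y).

Definition put (I : choiceType) (G : groupType) (x : direct_sum I G) (a : I)
  (g : G) : direct_sum I G := [fsfun x with a |-> g].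

Lemma putE (I : choiceType) (G : groupType) (x : direct_sum I G) a g i :
  put x a g i = if i == a then g else x i.
Proof. exact: fsfun_withE. Qed.

(* xi x moves the coordinates in J one after the other, each by zeta: once a  *)
(* has been given the same value in x and y, they only differ in the rest of  *)
(* J.                                                                         *)
Lemma direct_sum_kernel (I : choiceType) (G : groupType) (E S : {fset G})
    (e : R) (zeta : G -> fmeas R G) (J : seq I) :
    1%g \in E -> 0 <= e -> kernel_in S zeta ->
    (forall g h, (g^-1 * h)%g \in E -> l1close e (zeta g) (zeta h)) ->
  exists (T : {fset direct_sum I G}) xi, kernel_in T xi /\
    forall x y : direct_sum I G, (forall i, (x i)^-1 * y i \in E)%g ->
      (forall i, i \notin J -> x i = y i) ->
      l1close (e *+ size J) (xi x) (xi y).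
Proof.
move=> E1 e0 [pz Sz] cz; elim: J => [|a J [T [xi [[px Tx] cx]]]].
  exists [fset 1%g], (@dirac R _); split; first split.
  - exact: dirac_prob.
  - by move=> x z; rewrite finsupp_dirac !inE => /eqP ->; rewrite mulVg.
  move=> x y _ xy; have -> : x = y by apply/fsfunP => i; exact: xy.
  exact: l1close_refl.
pose xi' (x : direct_sum I G) := bind (zeta (x a)) (fun g => xi (put x a g)).
(* With g drawn from [zeta (x a)], the displacement x^-1 z factors through [put x a g]. Its first
   factor is trivial except at [a], where it is (x a)^-1 g in [S]; the second lies in [T]. *)
exists ((fun p => (put 1 a p.1 * p.2)%g) @` (S `*` T)), xi'; split; first split.
- by move=> x; apply: bind_prob.
- move=> x z /bind_finsupp[g /Sz gS /Tx zT]; apply/imfsetP => /=.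
  exists (((x a)^-1 * g)%g, ((put x a g)^-1 * z)%g).
    by rewrite !inE gS zT.
  rewrite /= mulgA; congr (_ * z)%g; apply/fsfunP => i.
  rewrite !(dsum_mulE, dsum_invE, putE); case: eqP => [->|_].
    by rewrite mulgK.
  by rewrite dsum_oneE mul1g.
- move=> x y xyE xyJ; rewrite mulrS; apply: bind_close => //.
  + by rewrite mulrn_wge0.
  + exact: cz.
  move=> g _; apply: cx => i; rewrite !putE; case: (eqVneq i a) => // ia.
    by rewrite mulVg.
  by move=> iJ; apply: xyJ; rewrite inE negb_or ia.
Qed.

Lemma wreath_mulE (G H : groupType) (x y : wreath G H) :
  (x * y)%g = ((x.1 * translate x.2 y.1)%g, (x.2 * y.2)%g).
Proof. by []. Qed.

Lemma wreath_invE (G H : groupType) (x : wreath G H) :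
  (x^-1)%g = (translate (x.2^-1) (x.1^-1), x.2^-1)%g.
Proof. by []. Qed.

Lemma translate_inv (G H : groupType) (h : H) (f : direct_sum H G) :
  (translate h f^-1 = (translate h f)^-1)%g.
Proof. by apply/fsfunP => i; rewrite !(dsum_invE, translateE). Qed.

(* A point over p in H is chosen by moving, inside the coset of the base      *)
(* group over p, away from (n, q) * (1, q^-1 p) = (1, p) * (p^-1 n, 1).       *)
Lemma reiter_wreath (G H : groupType) :
  reiter G -> reiter H -> reiter (wreath G H).
Proof.
move=> rG rH E e e0; pose e2 := e / 2; have e20 : 0 < e2 by rewrite divr_gt0.
have [S [eta [[pe Se] ce]]] := rH [fset u.2 | u in E] e2 e20.
(* Here q^-1 p ranges over [S] and (m, t) over [E], so [D] contains every change (p^-1 q) m of p^-1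
   n. [J] and [EG] collect the coordinates and the values that occur in [D]. *)
pose D := (fun p => translate (p.1)^-1%g p.2.1) @` (S `*` E).
pose J := \bigcup_(f <- D) finsupp f.
pose EG := 1%g |` \bigcup_(f <- D) [fset f i | i in finsupp f].
(* The error [e2] is shared among the coordinates in [J]; the successor keeps the denominator
   nonzero when [J] is empty. *)
pose e3 := e2 / (#|` J|).+1%:R; have e30 : 0 < e3 by rewrite divr_gt0.
have [T0 [zeta [kz cz]]] := rG EG e3 e30.
have [T [nu [[pn Tn] cn]]] :=
  direct_sum_kernel J (fset1U1 _ _) (ltW e30) kz cz.
(* This is the product (1, p) * (m, 1). *)
pose pt p (m : direct_sum H G) : wreath G H := (translate p m, p).
pose ker (x : wreath G H) p :=
  bind (nu (translate p^-1%g x.1)) (fun m => dirac R (pt p m)).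
pose xi (x : wreath G H) := bind (eta x.2) (ker x).
have pk x p : is_prob (ker x p) by apply: bind_prob => // *; exact: dirac_prob.
exists ((fun p => pt p.1 p.2) @` (S `*` T)), xi; split; first split.
- by move=> x; apply: bind_prob.
- move=> [n q] z /bind_finsupp[p /= /Se pS] /bind_finsupp[m /= /Tn mT].
  rewrite finsupp_dirac => /fset1P ->; apply/imfsetP.
  exists ((q^-1 * p)%g, ((translate p^-1 n)^-1 * m)%g).
    by rewrite /= in_fsetM pS.
  rewrite wreath_mulE wreath_invE; congr pair => /=.
  rewrite translate_mul -!translate_inv -!translateM.
  by rewrite mulgK.
- move=> x y xyE; have -> : e = e2 + e2 by rewrite /e2; lra.
  apply: bind_close => //; first exact: ltW.
    by apply: ce; apply/imfsetP; exists (x^-1 * y)%g.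
  move=> p /Se pS; apply: bind_close_same => // [m|]; first exact: dirac_prob.
  set f := translate _ x.1; set g := translate _ y.1.
  have fgD : (f^-1 * g)%g \in D.
    apply/imfsetP => /=; exists ((x.2^-1 * p)%g, (x^-1 * y)%g).
      by rewrite !inE pS.
    rewrite wreath_mulE wreath_invE /= translate_mul -!translateM.
    by rewrite invgM invgK mulgK translate_inv.
  have xyi i : ((f i)^-1 * g i)%g = (f^-1 * g)%g i.
    by rewrite dsum_mulE dsum_invE.
  have le23 : e3 *+ size J <= e2.
    rewrite -mulr_natr /e3 mulrAC ler_pdivrMr // ler_pM2l // ler_nat.
    exact: leqnSn.
  move=> F; apply: le_trans le23; apply: cn => i; rewrite ?xyi.
    rewrite !inE; case: finsuppP => [_|fgi]; first by rewrite eqxx.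
    apply/orP; right; apply/bigfcupP; exists (f^-1 * g)%g; first by rewrite fgD.
    by apply/imfsetP; exists i.
  move=> iJ; have : (f^-1 * g)%g i = 1%g.
    apply/fsfun_dflt/negP => fgi; move/negP: iJ; apply.
    by apply/bigfcupP; exists (f^-1 * g)%g; first by rewrite fgD.
  by rewrite -xyi => /(canRL (mulVKg _)) ->; rewrite mulg1.
Qed.

End Reiter.

(** * Property A and Reiter's condition *)

Section PropertyA.
Variable R : realType.

Lemma sumr_fset_const (X : choiceType) (F : {fset X}) (c : R) :
  \sum_(x <- F) c = c *+ #|` F|.
Proof. by rewrite big_const_seq count_predT iter_addr_0. Qed.

Lemma sum_mem_le (X : choiceType) (F D : {fset X}) :
  \sum_(x <- F) (x \in D)%:R <= #|` D|%:R :> R.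
Proof.
apply: le_trans (@ler_sum_fset R _ _ _ (F `|` D) _ (fsubsetUl _ _)) _ => //.
rewrite -(big_fset_incl _ (fsubsetUr F D)) => [|x _ /negbTE ->//].
by rewrite big_seq (eq_bigr (fun=> 1)) -?big_seq ?sumr_fset_const // => x ->.
Qed.

Definition unif (X : choiceType) (A : {fset X}) : fmeas R X :=
  [fsfun x in A => #|` A|%:R^-1].

Lemma unifE (X : choiceType) (A : {fset X}) x :
  unif A x = (x \in A)%:R / #|` A|%:R.
Proof. by rewrite fsfunE; case: ifP => _; rewrite ?mul1r ?mul0r. Qed.

Lemma unif_prob (X : choiceType) (A : {fset X}) :
  A != fset0 -> is_prob (unif A).
Proof.
move=> A0; split=> [x|]; first by rewrite unifE divr_ge0.
have sA : (finsupp (unif A) `<=` A)%fset by exact: finsupp_sub.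
rewrite (mass_finsupp sA) big_seq (eq_bigr (fun=> #|` A|%:R^-1)).
  rewrite -big_seq sumr_fset_const -[_ *+ _]mulr_natl divff //.
  by rewrite pnatr_eq0 cardfs_eq0.
by move=> x xA; rewrite unifE xA mul1r.
Qed.

(** Write a, b for the sizes of [A], [B] and [D] for their symmetric difference. The distance is at
    most |D|/a, from the points of [D], plus b |1/a - 1/b| = |b - a|/a <= |D|/a, from the different
    normalisations. Finally |D| < e |A cap B| <= e a. *)
Lemma unif_close (X : choiceType) (A B : {fset X}) (e : R) :
  A `&` B != fset0 ->
  #|` (A `\` B) `|` (B `\` A)|%:R / #|` A `&` B|%:R < e ->
  l1close (2 * e) (unif A) (unif B).
Proof.
rewrite -cardfs_gt0 => i0; set D := _ `|` _.
rewrite ltr_pdivrMr ?ltr0n // => De F.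
have Ai : (#|` A `&` B| <= #|` A|)%N by rewrite fsubset_leq_card ?fsubsetIl.
have Bi : (#|` A `&` B| <= #|` B|)%N by rewrite fsubset_leq_card ?fsubsetIr.
have /(leq_trans i0) a0 := Ai; have /(leq_trans i0) b0 := Bi.
have AD : (#|` A| <= #|` B| + #|` D|)%N.
  rewrite -(cardfsID B A) leq_add // fsubset_leq_card ?fsubsetIr //.
  exact: fsubsetUl.
have BD : (#|` B| <= #|` A| + #|` D|)%N.
  rewrite -(cardfsID A B) leq_add // fsubset_leq_card ?fsubsetIr //.
  exact: fsubsetUr.
move: Ai Bi a0 b0 AD BD i0; rewrite -!(ltr0n R) -!(ler_nat R) !natrD.
set a := #|` A|%:R; set b := #|` B|%:R; set i := #|` A `&` B|%:R.
move=> ai bi a0 b0 ab ba i0.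
pose h x : R := (x \in D)%:R / a + (x \in B)%:R * `|a^-1 - b^-1|.
have le_h x : `|unif A x - unif B x| <= h x.
  rewrite !unifE /h -/a -/b !inE.
  case: (x \in A); case: (x \in B);
    rewrite /= !(mul0r, mul1r, add0r, addr0, subr0, sub0r) //.
  - by rewrite ger0_norm // invr_ge0 ltW.
  - rewrite normrN ger0_norm ?invr_ge0 ?(ltW b0) // distrC.
    by have := ler_norm (b^-1 - a^-1); lra.
  - by rewrite oppr0 normr0.
apply: le_trans (ler_sum _ (fun x _ => le_h x)) _.
rewrite big_split /= -!mulr_suml.
have lD : (\sum_(x <- F) (x \in D)%:R) / a <= #|` D|%:R / a.
  by rewrite ler_pM2r ?invr_gt0 // sum_mem_le.
have lB : (\sum_(x <- F) (x \in B)%:R) * `|a^-1 - b^-1| <= b * `|a^-1 - b^-1|.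
  by rewrite ler_wpM2r // sum_mem_le.
apply: le_trans (lerD lD lB) _.
have -> : b * `|a^-1 - b^-1| = `|b - a| / a.
  rewrite -{1}[b]gtr0_norm // -normrM -[in RHS](@gtr0_norm _ a^-1) ?invr_gt0 //.
  rewrite -normrM; congr `|_|; rewrite mulrBr mulrBl.
  by rewrite !divff //; exact: lt0r_neq0.
rewrite -mulrDl ler_pdivrMr //.
have : `|b - a| <= #|` D|%:R by rewrite ler_norml; apply/andP; split; lra.
have e0 : 0 < e by rewrite -(pmulr_lgt0 _ i0) (le_lt_trans _ De).
have : e * i <= e * a by rewrite ler_pM2l.
by move: De; lra.
Qed.

Lemma left_invariantE (G : groupType) (d : G -> G -> R) x y :
  left_invariant d -> d x y = d 1%g (x^-1 * y)%g.
Proof. by move=> /(_ x^-1%g x y) <-; rewrite mulVg. Qed.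

Lemma property_A_reiter (G : groupType) : group_property_A R G -> reiter R G.
Proof.
move=> [d [[d0 _ _ _] dl bg pA]] E e e0.
(* The sum dominates each [d 1 g] with g in [E], and the 1 makes [r] positive. *)
pose r := 1 + \sum_(g <- E) d 1%g g.
have r0 : 0 < r by rewrite ltr_pwDl // sumr_ge0.
have e20 : 0 < e / 2 by rewrite divr_gt0.
have [A [A0 AR [s AS]]] := pA r (e / 2) r0 e20.
have s0 : 0 < Num.max s 1 by rewrite lt_max ltr01 orbT.
have [_ /(_ 1%g)[fS _]] := bg _ s0.
exists (fset_set (mball d 1%g (Num.max s 1))).
(* The uniform measure on [A x] is pushed forward to G by forgetting the natural number. *)
exists (fun x => bind (unif (A x)) (fun p => dirac R p.1)).
split; first split.
- move=> x; apply: bind_prob => [|p _]; [exact: unif_prob|exact: dirac_prob].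
- move=> x z /bind_finsupp[[y n]]; rewrite mem_finsupp unifE => yA.
  rewrite finsupp_dirac => /fset1P ->; rewrite in_fset_set // inE /mball /=.
  rewrite -left_invariantE // le_max (AS x y n) //.
  by apply: contraNT yA => /negbTE ->; rewrite mul0r.
- move=> x y xyE; apply: bind_close_same; first exact: unif_prob.
    by move=> p; exact: dirac_prob.
  have xyr : d x y <= r.
    rewrite (left_invariantE _ _ dl) ler_wpDl //.
    have := @ler_sum_fset R _ (d 1%g) _ _ (d0 1%g) (_ : [fset _] `<=` E)%fset.
    by rewrite -fsub1set in xyE => /(_ _ xyE); rewrite big_seq_fset1.
  have [Axy lt_e] := AR x y xyr.
  rewrite [e](_ : _ = 2 * (e / 2)); first exact: unif_close.
  by rewrite mulrC divfK ?pnatr_eq0.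
Qed.

End PropertyA.

Section OfReiter.
Variable R : realType.

Definition subgraph (X : choiceType) (V : {fset X}) (t : X -> nat) :
  {fset X * nat} := [fset p in [seq (x, n) | x <- V, n <- iota 0 (t x)]].

Lemma in_subgraph (X : choiceType) (V : {fset X}) (t : X -> nat) x n :
  ((x, n) \in subgraph V t) = (x \in V) && (n < t x)%N.
Proof.
rewrite !inE; apply/allpairsPdep/andP => [[y [m [yV]]]|[xV nt]].
  by rewrite mem_iota => /andP[_ mt] [-> ->].
by exists x, n; rewrite xV mem_iota.
Qed.

Lemma card_subgraph (X : choiceType) (V : {fset X}) (t : X -> nat) :
  #|` subgraph V t| = (\sum_(x <- V) t x)%N.
Proof.
rewrite card_fseq undup_id.
  rewrite size_allpairs_dep sumnE big_map.
  by apply: eq_bigr => x _; rewrite size_iota.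
apply: allpairs_uniq_dep => // [x _|]; first exact: iota_uniq.
by move=> [x n] [y m] _ _ /= [-> ->].
Qed.

Lemma reiter_property_A (G : groupType) (d : G -> G -> R) :
  is_metric d -> left_invariant d -> bounded_geometry d -> reiter R G ->
  property_A d.
Proof.
move=> [d0 d1 _ _] dl bg rG r e r0 e0.
have [_ /(_ 1%g)[fB _]] := bg r r0.
(* Chosen so that 2 del < e (1 - del), the inequality that closes the estimate of the ratio. *)
pose del := e / (3 + e).
have e30 : 0 < 3 + e by rewrite ltr_pwDl // ltW.
have del0 : 0 < del by rewrite divr_gt0.
have delE : del * (3 + e) = e by rewrite divfK // lt0r_neq0.
have del1 : del < 1 by rewrite ltr_pdivrMr //; lra.
have [S [xi [[px Sx] cx]]] := rG (fset_set (mball d 1%g r)) del del0.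
(* Rounding loses at most 1 at each of at most 2|S| points; this [K] makes that loss smaller than K
   del / 2. *)
pose K : R := (4 * #|` S|%:R + 1) / del.
have K0 : 0 < K by rewrite divr_gt0 // ltr_wpDl // mulr_ge0.
have KE : K * del = 4 * #|` S|%:R + 1 by rewrite divfK // lt0r_neq0.
pose t x y := Num.trunc (K * xi x y).
have Kx0 x y : 0 <= K * xi x y by rewrite mulr_ge0 ?(ltW K0) ?(px x).1.
have tle x y : (t x y)%:R <= K * xi x y by rewrite truncn_le.
have tgt x y : K * xi x y - 1 <= (t x y)%:R.
  by rewrite lerBlDr natr1 ltW // truncnS_gt.
pose A x := subgraph (finsupp (xi x)) (t x).
have AV x (V : {fset G}) :
    (finsupp (xi x) `<=` V)%fset -> A x = subgraph V (t x).
  move=> sV; apply/fsetP => -[y n]; rewrite !in_subgraph.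
  case: (boolP (y \in finsupp (xi x))) => [/(fsubsetP sV) ->//|xi0].
  by rewrite /t fsfun_dflt // mulr0 truncn0; case: (y \in V).
have AK x : #|` A x|%:R <= K.
  rewrite card_subgraph natr_sum.
  apply: le_trans (ler_sum _ (fun y _ => tle x y)) _.
  by rewrite -mulr_sumr (px x).2 mulr1.
have cS x : (#|` finsupp (xi x)| <= #|` S|)%N.
  have /fsubset_leq_card/leq_trans :
      (finsupp (xi x) `<=` (fun s => x * s)%g @` S)%fset.
    apply/fsubsetP => z /Sx zS; apply/imfsetP; exists (x^-1 * z)%g => //=.
    by rewrite mulVKg.
  by apply; exact: leq_imfset_card.
have main x y : d x y <= r -> K * (1 - del) <= #|` A x `&` A y|%:R.
  move=> xyr; have xiD : l1close del (xi x) (xi y).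
    by apply: cx; rewrite in_fset_set // inE /mball /= -left_invariantE.
  pose V := finsupp (xi x) `|` finsupp (xi y).
  have AI : A x `&` A y = subgraph V (fun z => minn (t x z) (t y z)).
    rewrite (AV x V) ?fsubsetUl // (AV y V) ?fsubsetUr //.
    apply/fsetP => -[z n]; rewrite in_fsetI !in_subgraph.
    by rewrite leq_min andbACA andbb.
  rewrite AI card_subgraph natr_sum.
  (* From min(u, v) = (u + v - |u - v|) / 2, with a loss of at most 1 for rounding. *)
  have lem z : K / 2 * (xi x z + xi y z - `|xi x z - xi y z|) - 1 <=
      (minn (t x z) (t y z))%:R.
    rewrite /minn; have tx := tgt x z; have ty := tgt y z.
    have n1 : K * (xi x z - xi y z) <= K * `|xi x z - xi y z|.
      by rewrite ler_pM2l // ler_norm.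
    have n2 : K * (xi y z - xi x z) <= K * `|xi x z - xi y z|.
      by rewrite ler_pM2l // distrC ler_norm.
    by case: ifP => _; lra.
  apply: le_trans (ler_sum _ (fun z _ => lem z)).
  rewrite sumrB -mulr_sumr sumrB big_split /= sumr_fset_const.
  rewrite -(mass_finsupp (fsubsetUl _ _)) (px x).2.
  rewrite -(mass_finsupp (fsubsetUr _ _)) (px y).2.
  have cV : (#|` V|)%:R <= 2 * #|` S|%:R :> R.
    rewrite -natrM ler_nat mul2n -addnn.
    by apply: leq_trans (leq_add (cS x) (cS y)); rewrite cardfsU leq_subr.
  have := xiD V; set s := \sum_(_ <- _) _ => sdel.
  have : K * s <= K * del by rewrite ler_pM2l.
  by move: cV KE; rewrite -/V; lra.
have AI0 x y : d x y <= r -> A x `&` A y != fset0.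
  move/main => lK; rewrite -cardfs_gt0 -(ltr0n R); apply: lt_le_trans lK.
  by rewrite mulr_gt0 // subr_gt0.
exists A; split.
- by move=> x; rewrite -[A x]fsetIid AI0 // (d1 x x).2 // ltW.
- move=> x y xyr; split; first exact: AI0.
  have i0 : 0 < #|` A x `&` A y|%:R :> R by rewrite ltr0n cardfs_gt0 AI0.
  rewrite ltr_pdivrMr //.
  (* The symmetric difference thus has at most 2K - 2K (1 - del) = 2K del points. *)
  have Di : (#|` (A x `\` A y) `|` (A y `\` A x)| +
      (#|` A x `&` A y| + #|` A x `&` A y|) <= #|` A x| + #|` A y|)%N.
    rewrite -(cardfsID (A y) (A x)) -(cardfsID (A x) (A y)).
    rewrite [A y `&` A x]fsetIC addnACA addnC leq_add2l.
    by rewrite cardfsU leq_subr.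
  move: Di; rewrite -(ler_nat R) !natrD => Di.
  have ei : e * (K * (1 - del)) <= e * #|` A x `&` A y|%:R.
    by rewrite ler_pM2l // main.
  have Ax := AK x; have Ay := AK y; have i := main x y xyr.
  have : K * (2 * del) < K * (e * (1 - del)).
    by rewrite ltr_pM2l //; lra.
  by lra.
exists (\sum_(s <- S) d 1%g s) => x y n.
rewrite in_subgraph => /andP[/Sx xyS _]; rewrite (left_invariantE _ _ dl).
have := @ler_sum_fset R _ (d 1%g) _ _ (d0 1%g) (_ : [fset _] `<=` S)%fset.
by rewrite -fsub1set in xyS => /(_ _ xyS); rewrite big_seq_fset1.
Qed.

End OfReiter.

(** * Proper left-invariant metrics on countable groups *)

Section WordMetric.
Variables (R : realType) (G : groupType) (c : G -> nat).
Hypothesis c_inj : injective c.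
Local Open Scope group_scope.

(** All elements serve as generators, since G need not be finitely generated. Weights are symmetric
    and positive, and by injectivity of [c] only finitely many elements lie below any bound, so
    balls are finite. *)
Definition weight (a : G) : nat := (minn (c a) (c a^-1)).+1.

Inductive reach : nat -> G -> Prop :=
| reach1 : reach 0 1
| reachM n a g : reach n g -> reach (weight a + n) (a * g).

Lemma weightV a : weight a^-1 = weight a.
Proof. by rewrite /weight invgK minnC. Qed.

Lemma reach_mul m n g h : reach m g -> reach n h -> reach (m + n) (g * h).
Proof.
move=> + rh; elim=> [|k a {}g _ IH]; first by rewrite mul1g.
by rewrite -addnA -mulgA; exact: reachM.
Qed.

Lemma reach_weight a : reach (weight a) a.
Proof. by have := reachM a reach1; rewrite addn0 mulg1. Qed.

Lemma reachV n g : reach n g -> reach n g^-1.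
Proof.
elim=> [|k a {}g _ IH]; first by rewrite invg1; exact: reach1.
rewrite invgM addnC; apply: reach_mul => //.
by rewrite -weightV; exact: reach_weight.
Qed.

Lemma reach0 g : reach 0 g -> g = 1.
Proof. by move=> r; inversion r. Qed.

Lemma finite_weight n : finite_set [set a | (weight a <= n)%N]%classic.
Proof.
have fc (f : G -> nat) : injective f -> finite_set (f @^-1` `I_n)%classic.
  by move=> fI; apply: finite_preimage (finite_II n) => x y _ _; exact: fI.
apply: sub_finite_set (_ : finite_set (c @^-1` `I_n `|`
    (fun a => c a^-1) @^-1` `I_n))%classic.
  by move=> a /=; rewrite /weight gtn_min => /orP[]; [left|right].
rewrite finite_setU; split; apply: fc => // x y /c_inj; exact: invg_inj.
Qed.

Lemma finite_reach N :
  finite_set [set g | exists2 n, (n <= N)%N & reach n g]%classic.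
Proof.
elim: N => [|N IH].
  apply: sub_finite_set (finite_set1 (1 : G)) => g [n].
  by rewrite leqn0 => /eqP -> /reach0.
pose B := [set g | exists2 n, (n <= N)%N & reach n g]%classic.
pose W := [set a | (weight a <= N.+1)%N]%classic.
apply: sub_finite_set (_ : finite_set
    (1 |` [set p.1 * p.2 | p in W `*` B]))%classic.
  (* Removing the first letter lowers the total weight by at least 1, so the rest falls under the
     induction hypothesis. *)
  move=> g [n nN rg]; case: rg nN => [_|k a {}g rg kN]; first by left.
  right; exists (a, g) => //; split=> /=.
    exact: leq_trans (leq_addr _ _) kN.
  exists k => //; rewrite -ltnS (leq_trans _ kN) //.
  by rewrite /weight addSn ltnS leq_addl.
rewrite finite_setU; split; first exact: finite_set1.
apply: finite_image; apply: finite_setX => //; exact: finite_weight.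
Qed.

Lemma ex_reach g : exists n, `[< reach n g >].
Proof. by exists (weight g); apply/asboolP; exact: reach_weight. Qed.

Definition len g := ex_minn (ex_reach g).

Lemma reach_len g : reach (len g) g.
Proof. by rewrite /len; case: ex_minnP => n /asboolP. Qed.

Lemma len_le n g : reach n g -> (len g <= n)%N.
Proof.
by move=> r; rewrite /len; case: ex_minnP => m _; apply; apply/asboolP.
Qed.

Definition word_dist (x y : G) : R := ((len (x^-1 * y))%:R)%R.

Lemma word_dist_metric : is_metric word_dist.
Proof.
split.
- by move=> x y; rewrite /word_dist ler0n.
- move=> x y; split=> [/eqP|->].
    rewrite /word_dist pnatr_eq0 => /eqP l0.
    have := reach_len (x^-1 * y); rewrite l0 => /reach0 /(canRL (mulVKg _)).
    by rewrite mulg1.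
  apply/eqP; rewrite /word_dist mulVg pnatr_eq0 -leqn0; exact/len_le/reach1.
- move=> x y; suff le u v : (len (u^-1 * v) <= len (v^-1 * u))%N.
    by congr (_%:R)%R; apply/eqP; rewrite eqn_leq !le.
  rewrite -[u^-1 * v]invgK invgM invgK; exact/len_le/reachV/reach_len.
move=> x y z; rewrite /word_dist -natrD ler_nat.
have -> : x^-1 * z = (x^-1 * y) * (y^-1 * z) by rewrite -mulgA mulVKg.
by apply/len_le/reach_mul; exact: reach_len.
Qed.

Lemma word_dist_left_invariant : left_invariant word_dist.
Proof. by move=> h g k; rewrite /word_dist invgM -mulgA mulKg. Qed.

Lemma word_dist_bounded_geometry : bounded_geometry word_dist.
Proof.
move=> r r0; have /finite_fsetP[B BE] := finite_reach (Num.trunc r).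
have bE x :
    (mball word_dist x r `<=` [set` ((fun g => x * g) @` B)%fset])%classic.
  move=> y xy; apply/imfsetP; exists (x^-1 * y); last by rewrite mulVKg.
  have : [set` B]%classic (x^-1 * y).
    rewrite -BE; exists (len (x^-1 * y)); last exact: reach_len.
    by rewrite truncn_ge_nat // ltW.
  by [].
have fB x : finite_set (mball word_dist x r).
  by apply: sub_finite_set (bE x) _; exact: finite_fset.
exists (#|` B|).+1 => x; split => //; rewrite ltnS.
have /fsubset_leq_card/leq_trans : (fset_set (mball word_dist x r) `<=`
    (fun g => x * g) @` B)%fset.
  by apply/fsubsetP => y; rewrite in_fset_set // inE => /bE.
by apply; exact: leq_imfset_card.
Qed.

End WordMetric.

Lemma countable_wreath (G H : groupType) :
  countable [set: G]%classic -> countable [set: H]%classic ->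
  exists c : wreath G H -> nat, injective c.
Proof.
move=> /countable_injP[a /in2TT aI] /countable_injP[b /in2TT bI].
(* The graph of [f] over its support, as a list of pairs of naturals, determines [f]. *)
pose gr (f : direct_sum H G) := [seq (b i, a (f i)) | i <- finsupp f].
exists (fun x => choice.pickle (gr x.1, b x.2)) => -[f h] [f' h'].
move=> /(pcan_inj choice.pickleK) [ff /bI ->]; congr pair.
have sub (u v : direct_sum H G) : gr u = gr v ->
    forall i, i \in finsupp u -> u i = v i.
  move=> uv i iu; have : (b i, a (u i)) \in gr u by apply: map_f.
  by rewrite uv => /mapP[j _ [/bI <- /aI]].
apply/fsfunP => i; case: (boolP (i \in finsupp f)) => [|fi]; first exact: sub.
case: (boolP (i \in finsupp f')) => [|f'i]; first by move=> ?; apply/esym/sub.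
by rewrite !fsfun_dflt.
Qed.

Theorem mainTheorem3 (R : realType) (G H : groupType)
    (cG : countable [set: G]%classic) (cH : countable [set: H]%classic)
    (AG : group_property_A R G) (AH : group_property_A R H) :
  group_property_A R (wreath G H).
Proof.
have [c cI] := countable_wreath cG cH.
have mW := word_dist_metric R c; have lW := @word_dist_left_invariant R _ c.
have bW := @word_dist_bounded_geometry R _ _ cI.
exists (word_dist R c); split => //.
apply: reiter_property_A => //.
by apply: reiter_wreath; exact: property_A_reiter.
Qed.
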